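(* Let $d\geq 2$ be a prime. (a) For $n\ge 7$, every $(n-1)$-controlled special unitary gate $\mathrm{C}^{n}_{(1,\dots,n-1),n}(U)$, $U\in\mathrm{SU}(\mathcal{H}_d)$, can be synthesized using at most $d\,N_{\mathrm{SU}}(d,n)$ SUM gates. (b) For $n\ge 3$, every $(n-1)$-controlled unitary gate $\mathrm{C}^{n}_{(1,\dots,n-1),n}(U)$, $U\in\mathrm{U}(\mathcal{H}_d)$, can be synthesized using at most $d\,N_{\mathrm{U}}(d,n)$ SUM gates.
   Context: For $m\ge 7$, $N_{\mathrm{SU}}(d,m)$ equals $16m-48$ if $d=2$, $32m-160$ if $d=3$, and $(32d-40)m-192d+272$ if $d\ge4$. For $m\ge3$, $N^{\mathrm{rec}}_{\mathrm{SU}}(m)=2^{2k}+3\cdot 2^{k}(m-2^{k}-1)$ with $k=\lfloor\log_2(m-1)\rfloor$. For $n\ge3$, $N_{\mathrm{U}}(d,n)=2+\sum_{m=3}^{n}\min\{N_{\mathrm{SU}}^{\mathrm{rec}}(m),N_{\mathrm{SU}}(d,m)\}$, where for $3\le m\le6$ the minimum is taken to be $N_{\mathrm{SU}}^{\mathrm{rec}}(m)$. $\mathcal{H}_{d}$ is a $d$-dimensional complex Hilbert space with orthonormal (computational) basis $|0\rangle,\dots,|d-1\rangle$ (a qudit); $\mathrm{U}(\mathcal{H}_d)$ is the group of unitary operators and $\mathrm{SU}(\mathcal{H}_d)$ those of determinant $1$. $X_d=|0\rangle\langle d-1|+\sum_{a=0}^{d-2}|a+1\rangle\langle a|$. $\mathrm{C}^{n}_{(1,\dots,n-1),n}(U)\in\mathrm{U}(\mathcal{H}_d^{\otimes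 n})$ acts on $|x_1\dots x_n\rangle$ by applying $U$ to the last tensor factor if $x_1=\dots=x_{n-1}=d-1$, and as the identity otherwise. $\mathrm{SUM}=\sum_{a=0}^{d-1}|a\rangle\langle a|\otimes X_d^{a}$; a SUM gate on $n$ qudits is this operator applied to any ordered pair of distinct qudits (first one control, second one target). A single-qudit gate is an arbitrary unitary acting nontrivially on one tensor factor only. ''Synthesized using at most $N$ SUM gates'' means: equal, as an operator on the given $n$ qudits (no ancilla), to a finite product of SUM gates and single-qudit gates in which at most $N$ factors are SUM gates. *)

(* Defs.v *)
From mathcomp Require Import all_boot all_order all_algebra.
From mathcomp Require Export reals.
From mathcomp Require Export complex.

Set Implicit Arguments.
Unset Strict Implicit.
Unset Printing Implicit Defensive.

Import Order.TTheory GRing.Theory Num.Theory.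
Local Open Scope ring_scope.

(* The count formulas are integer-valued, so that their subtractions are never
   truncated.  [trunc_log 2 m] is floor (log_2 m) for m > 0. *)

(* Meaningful for d >= 2 and m >= 7. *)
Definition N_SU (d m : nat) : int :=
  if d == 2%N then 16 * m%:Z - 48
  else if d == 3%N then 32 * m%:Z - 160
  else (32 * d%:Z - 40) * m%:Z - 192 * d%:Z + 272.

(* Meaningful for m >= 3. *)
Definition N_SU_rec (m : nat) : int :=
  let k := trunc_log 2 m.-1 in
  2 ^+ (2 * k) + 3 * 2 ^+ k * (m%:Z - 2 ^+ k - 1).

(* Meaningful for n >= 3. *)
Definition N_U (d n : nat) : int :=
  2 + \sum_(3 <= m < n.+1)
        (if (m <= 6)%N then N_SU_rec m else Num.min (N_SU_rec m) (N_SU d m)).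

(* Labels (x_1, ..., x_n) of the computational basis of n qudits; the qudit
   written k = 1, ..., n in the literature has index k - 1 in 'I_n. *)
Notation label n d := {ffun 'I_n -> 'I_d}.

(* Operators on n qudits, as matrices in the computational basis, whose vectors
   are enumerated by [basis_label]: the entry at (r, s) is <x| V |y> where
   x = basis_label r and y = basis_label s, so that operators act on columns. *)
Notation qudit_op C n d := 'M[C]_#|label n d|.

Section Circuits.
Variables (C : numClosedFieldType) (n d : nat).

Definition basis_label (r : 'I_#|label n d|) : label n d := enum_val r.

(* The tensor product A_1 (x) ... (x) A_n. *)
Definition tens (A : 'I_n -> 'M[C]_d) : qudit_op C n d :=
  \matrix_(r, s) \prod_(k < n) A k (basis_label r k) (basis_label s k).

Definition on_qudit (k : 'I_n) (A : 'M[C]_d) : qudit_op C n d :=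
  tens (fun l => if l == k then A else 1%:M).

(* X |b> = |b + 1 mod d> *)
Definition shiftX : 'M[C]_d := \matrix_(a, b) (a == ordS b)%:R.

(* sum_a |a><a| (x) X^a, with control i and target j *)
Definition SUM (i j : 'I_n) : qudit_op C n d :=
  \sum_(a < d) tens (fun l => if l == i then delta_mx a a
                              else if l == j then shiftX ^+ a
                              else 1%:M).

(* The first n - 1 qudits all carry the value d - 1. *)
Definition controls_on (y : label n d) : bool :=
  [forall k : 'I_n, (k < n.-1)%N ==> (y k == d.-1 :> nat)].

(* Column y is the image of |y>: apply U to the last qudit if the controls
   are on, and nothing otherwise. *)
Definition controlled (U : 'M[C]_d) : qudit_op C n d :=
  \matrix_(r, s)
    (if controls_on (basis_label s)
     then tens (fun l => if l == n.-1 :> nat then U else 1%:M)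
     else 1%:M) r s.

Inductive gate :=
  | SingleGate of 'I_n & 'M[C]_d
  | SumGate of 'I_n & 'I_n.

Definition gate_op (g : gate) : qudit_op C n d :=
  match g with
  | SingleGate k A => on_qudit k A
  | SumGate i j => SUM i j
  end.

Definition gate_wf (g : gate) : bool :=
  match g with
  | SingleGate _ A => A \is unitarymx
  | SumGate i j => i != j
  end.

Definition is_sum (g : gate) : bool :=
  if g is SumGate _ _ then true else false.

Definition synthesizable (N : int) (V : qudit_op C n d) : Prop :=
  exists c : seq gate,
    [/\ all gate_wf c, V = \prod_(g <- c) gate_op g
      & (count is_sum c)%:Z <= N].

End Circuits.

(* Main.v *)
(** A unitary of determinant 1 is a group commutator of two unitaries of
determinant 1: after diagonalization, of a diagonal matrix and the shift X.
Splitting the controls of a controlled gate into two halves and distributing the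
two matrices of the commutator over them gives the recursion behind [N_SU_rec].
It starts with a single control, which costs d SUM gates because
(X^e A)^d = (det A) 1 for A diagonal and e prime to d, whereas (X^d A)^d = A^d.

For linear cost, split the controls in halves once; each half can then use the
qudits of the other half as dirty ancillas.  A ladder of relative-phase gates
yields a monomial operator V that adds 1 to the target exactly when all controls
of the half are on, up to phases and to changes of the ancillas.  For A diagonal
on the target, V^* A V A^* is diagonal: the phases and the ancillas drop out, and
what remains is a controlled gate whose matrix is X^* A X A^*, i.e. any diagonal
matrix of determinant 1.

A unitary of arbitrary determinant differs from one of determinant 1 by a scalar,
and the controlled scalar is a controlled gate with one control less. *)

Require Import Defs.
From mathcomp Require Import all_boot all_order all_algebra.
From mathcomp Require Import zify ring.

Set Implicit Arguments.
Unset Strict Implicit.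
Unset Printing Implicit Defensive.

Import Order.TTheory GRing.Theory Num.Theory.
Local Open Scope ring_scope.
Local Open Scope sesquilinear_scope.

(** * Adjoints, and operators on one qudit conditioned on the others *)

Lemma unitary_adjmulK (C : numClosedFieldType) m (Q : 'M[C]_m) :
  Q \is unitarymx -> Q^t* *m Q = 1%:M.
Proof. by move=> Qu; rewrite -invmx_unitary// mulVmx// unitarymx_unit. Qed.

Lemma trmxC1 (C : numClosedFieldType) m : (1%:M : 'M[C]_m)^t* = 1%:M.
Proof. by rewrite trmx1 map_scalar_mx rmorph1. Qed.

Lemma trmxCM (C : numClosedFieldType) m p q (A : 'M[C]_(m, p)) (B : 'M_(p, q)) :
  (A *m B)^t* = B^t* *m A^t*.
Proof. by rewrite trmx_mul map_mxM. Qed.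

Section Operators.
Variables (C : numClosedFieldType) (n d : nat).
Implicit Types (x y z : label n d) (k i j t : 'I_n) (M N : label n d -> 'M[C]_d).
Implicit Types V W : qudit_op C n d.

Definition upd y k b : label n d := [ffun l => if l == k then b else y l].

Lemma upd_same y k b : upd y k b k = b.
Proof. by rewrite ffunE eqxx. Qed.

Lemma upd_other y k b l : l != k -> upd y k b l = y l.
Proof. by rewrite ffunE => /negPf->. Qed.

Lemma upd_upd y k b c : upd (upd y k b) k c = upd y k c.
Proof. by apply/ffunP=> l; rewrite !ffunE; case: eqP. Qed.

Lemma upd_id y k : upd y k (y k) = y.
Proof. by apply/ffunP=> l; rewrite ffunE; case: eqP => [->|]. Qed.

Lemma upd_eqC x y k : (x == upd y k (x k)) = (y == upd x k (y k)).
Proof.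
by apply/eqP/eqP => e; rewrite e upd_upd upd_id.
Qed.

Lemma sum_basis_label (V : nmodType) (F : label n d -> V) :
  \sum_r F (basis_label r) = \sum_y F y.
Proof.
rewrite (reindex (@enum_val (label n d) predT)) //=.
exact/onW_bij/enum_val_bij.
Qed.

Lemma basis_label_inj : injective (@basis_label n d).
Proof. exact: enum_val_inj. Qed.

Lemma sum_upd z k (G : label n d -> C) :
  \sum_(y : label n d) (y == upd z k (y k))%:R * G y = \sum_b G (upd z k b).
Proof.
rewrite (partition_big (fun y : label n d => y k) predT) //=; apply: eq_bigr => b _.
rewrite (bigD1 (upd z k b)) /= upd_same ?eqxx ?mul1r//.
rewrite big1 ?addr0// => y /andP[/eqP yb]; rewrite yb => /negPf->.
by rewrite mul0r.
Qed.

(* M y acts on qudit k when the other qudits are in the state given by y; this is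
   meaningful only when M y does not depend on y k, i.e. under [indep k M]. *)
Definition blk k M : qudit_op C n d :=
  \matrix_(r, s) ((basis_label r == upd (basis_label s) k (basis_label r k))%:R
     * M (basis_label s) (basis_label r k) (basis_label s k)).

Definition indep k M := forall y b, M (upd y k b) = M y.

Lemma eq_blk k M N : M =1 N -> blk k M = blk k N.
Proof. by move=> eqMN; apply/matrixP=> r s; rewrite !mxE eqMN. Qed.

Lemma blk_mul k M N : indep k M ->
  blk k M *m blk k N = blk k (fun y => M y *m N y).
Proof.
move=> Mk; apply/matrixP=> r s; rewrite !mxE.
set x := basis_label r; set z := basis_label s.
under eq_bigr do rewrite !mxE -/x -/z.
rewrite (sum_basis_label (fun y : label n d => (x == upd y k (x k))%:R * M y (x k) (y k) *
  ((y == upd z k (y k))%:R * N z (y k) (z k)))).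
under eq_bigr do rewrite mulrCA.
rewrite sum_upd mulr_sumr; apply: eq_bigr => b _.
by rewrite upd_same upd_upd Mk mulrA.
Qed.

Lemma blk1 k : blk k (fun=> 1%:M) = 1%:M.
Proof.
apply/matrixP=> r s; rewrite !mxE -(inj_eq basis_label_inj) -natrM mulnb.
congr (nat_of_bool _)%:R; apply/andP/eqP => [[/eqP e1 /eqP e2]|->].
  by rewrite e1 e2 upd_id.
by rewrite upd_id.
Qed.

Lemma blk_adj k M : indep k M -> (blk k M)^t* = blk k (fun y => (M y)^t*).
Proof.
move=> Mk; apply/matrixP=> r s; rewrite !mxE rmorphM rmorph_nat.
rewrite upd_eqC; case: eqP => [e|_]; last by rewrite !mul0r.
by rewrite {1}e Mk.
Qed.

(** Matches the Kronecker deltas of the identity tensor factors with the single indicator in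
    [blk]. *)
Lemma agree_prod x y k :
  (x == upd y k (x k))%:R = \prod_(l < n | l != k) (x l == y l)%:R :> C.
Proof.
case: (pickP (fun l => (l != k) && (x l != y l))) => [l /andP[lk xyl]|xy].
  rewrite (bigD1 l) //= (negPf xyl) mul0r; case: eqP => // e.
  by rewrite e upd_other// eqxx in xyl.
rewrite big1 => [|l lk]; last by move: (xy l); rewrite lk /= => /negbFE->.
suff -> : x = upd y k (x k) by rewrite upd_same eqxx.
apply/ffunP => l; rewrite ffunE; case: eqP => [->//|/eqP lk].
by move: (xy l); rewrite lk /= => /negbFE/eqP.
Qed.

Lemma tens1E k (A : 'M[C]_d) : tens (fun l => if l == k then A else 1%:M) = blk k (fun=> A).
Proof.
apply/matrixP=> r s; rewrite !mxE (bigD1 k) //= eqxx mulrC agree_prod.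
by congr (_ * _); apply: eq_bigr => l /negPf->; rewrite mxE.
Qed.

(** Of the sum over [a], only the projector onto the actual value of the control survives. *)
Lemma SUM_blk i j : i != j -> SUM C d i j = blk j (fun y => shiftX C d ^+ y i).
Proof.
move=> ij; apply/matrixP=> r s; rewrite summxE !mxE agree_prod.
rewrite (bigD1 (basis_label s i)) //= !mxE (bigD1 j) //= eq_sym (negPf ij) eqxx mulrC.
rewrite [X in _ + X]big1 ?addr0 => [|a ai].
  congr (_ * _); apply: eq_bigr => l /negPf->.
  by case: (l =P i) => [->|_]; rewrite !mxE ?eqxx ?andbT.
rewrite !mxE (bigD1 i) //= eqxx !mxE.
by rewrite [basis_label s i == a]eq_sym (negPf ai) andbF mul0r.
Qed.

Definition on (S : seq 'I_n) y := all (fun k => y k == d.-1 :> nat) S.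

(** The controls form an arbitrary list and all further qudits are spectators: the recursion works
    with sublists of controls, and the ladder with spare qudits. *)
Definition ctl S t (U : 'M[C]_d) := blk t (fun y => if on S y then U else 1%:M).

Lemma on_upd S t y b : t \notin S -> on S (upd y t b) = on S y.
Proof.
move=> tS; apply: eq_in_all => k kS; rewrite upd_other//.
by apply: contraNneq tS => <-.
Qed.

Lemma indep_ctl S t (A B : 'M[C]_d) : t \notin S -> indep t (fun y => if on S y then A else B).
Proof. by move=> tS y b; rewrite on_upd. Qed.

Lemma ctl_mul S t (U V : 'M[C]_d) : t \notin S -> ctl S t U *m ctl S t V = ctl S t (U *m V).
Proof.
move=> tS; rewrite blk_mul; last exact: indep_ctl.
by apply: eq_blk => y; case: ifP => // _; rewrite mul1mx.
Qed.

Lemma ctl_adj S t U : t \notin S -> (ctl S t U)^t* = ctl S t (U^t*).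
Proof.
move=> tS; rewrite blk_adj; last exact: indep_ctl.
by apply: eq_blk => y; case: ifP; rewrite ?trmxC1.
Qed.

End Operators.

Lemma controlled_ctl (C : numClosedFieldType) n d (t : 'I_n) (U : 'M[C]_d) :
  t = n.-1 :> nat ->
  controlled n U = ctl [seq k <- enum 'I_n | k != t] t U.
Proof.
move=> tn; rewrite /ctl.
have onE y : on [seq k <- enum 'I_n | k != t] y = controls_on y.
  apply/allP/forallP => [H k|H k].
    apply/implyP => kn; apply: H; rewrite mem_filter mem_enum andbT.
    by apply: contraTneq kn => ->; rewrite tn ltnn.
  rewrite mem_filter => /andP[kt _]; apply: (implyP (H k)).
  by rewrite -tn ltn_neqAle kt /= tn -ltnS (ltn_predK (ltn_ord k)).
have tE : tens (fun l : 'I_n => if l == n.-1 :> nat then U else 1%:M)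
        = blk t (fun=> U).
  rewrite -tens1E; apply/matrixP => r s; rewrite !mxE; apply: eq_bigr => l _.
  by rewrite -tn.
apply/matrixP => r s; rewrite mxE tE -[in 1%:M](blk1 _ _ t).
by case: ifP => H; rewrite !mxE onE H ?mxE.
Qed.

(** * Shifts, synthesizable circuits, monomial operators *)

Section Circuits.
Variables (C : numClosedFieldType) (n d : nat).
Implicit Types (x y z : label n d) (k i j t : 'I_n) (M : label n d -> 'M[C]_d) (N : int).
Implicit Types V W : qudit_op C n d.

Definition fun_mx (f : 'I_d -> 'I_d) : 'M[C]_d := \matrix_(a, b) (a == f b)%:R.

Lemma fun_mxM f g : fun_mx f *m fun_mx g = fun_mx (f \o g).
Proof.
apply/matrixP => a b; rewrite !mxE (bigD1 (g b)) //= !mxE eqxx mulr1.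
by rewrite big1 ?addr0// => c /negPf cg; rewrite !mxE cg mulr0.
Qed.

Lemma fun_mx_id f : f =1 id -> fun_mx f = 1%:M.
Proof. by move=> fid; apply/matrixP => a b; rewrite !mxE fid. Qed.

Lemma fun_mx_adj f g : cancel f g -> cancel g f -> (fun_mx f)^t* = fun_mx g.
Proof.
move=> fK gK; apply/matrixP => a b; rewrite !mxE rmorph_nat.
by congr (nat_of_bool _)%:R; apply/eqP/eqP => ->; rewrite ?fK ?gK.
Qed.

Lemma fun_mx_unitary f g : cancel f g -> cancel g f -> fun_mx f \is unitarymx.
Proof.
move=> fK gK; apply/unitarymxP.
by rewrite (fun_mx_adj fK gK) fun_mxM fun_mx_id.
Qed.

Lemma shiftXE e : shiftX C d ^+ e = fun_mx (iter e (@ordS d)).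
Proof.
elim: e => [|e IH]; first by rewrite expr0; apply/esym/fun_mx_id.
by rewrite exprS IH -mulmxE fun_mxM.
Qed.

Lemma iter_ordSK e : cancel (iter e (@ordS d)) (iter e (@ord_pred d)).
Proof. by elim: e => // e IH b; rewrite iterSr iterS ordSK IH. Qed.

Lemma iter_ord_predK e : cancel (iter e (@ord_pred d)) (iter e (@ordS d)).
Proof. by elim: e => // e IH b; rewrite iterSr iterS ord_predK IH. Qed.

Lemma shiftX_unitary e : shiftX C d ^+ e \is unitarymx.
Proof. rewrite shiftXE; exact: fun_mx_unitary (iter_ordSK e) (iter_ord_predK e). Qed.

Lemma val_iter_ordS e (b : 'I_d) : iter e (@ordS d) b = ((b + e) %% d)%N :> nat.
Proof.
elim: e => [|e IH]; first by rewrite addn0 modn_small.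
by rewrite iterS /= IH -addn1 modnDml addn1 addnS.
Qed.

(** The reversal b |-> d - 1 - b conjugates b |-> b + 1 to b |-> b - 1. This makes the adjoint of
    SUM cost one SUM gate instead of d - 1. *)
Lemma shiftX_adj e :
  (shiftX C d ^+ e)^t* = fun_mx (@rev_ord d) *m shiftX C d ^+ e *m fun_mx (@rev_ord d).
Proof.
rewrite shiftXE !fun_mxM (fun_mx_adj (iter_ordSK e) (iter_ord_predK e)).
apply/matrixP => a b; rewrite !mxE; congr (_ == _)%:R => /=.
(* S R S = R for the successor S and the reversal R; the wrap-around at c = d - 1 is a separate
   case. *)
have revS (c : 'I_d) : ordS (rev_ord (ordS c)) = rev_ord c.
  apply: val_inj; rewrite /= /ordS /=.
  have cd := ltn_ord c; case: (ltnP c.+1 d) => h.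
    by rewrite (modn_small h) subnSK// modn_small//; lia.
  have -> : c.+1 = d by lia.
  by rewrite modnn subnn subn1 prednK ?modnn//; lia.
have revSe c : iter e (@ordS d) (rev_ord (iter e (@ordS d) c)) = rev_ord c.
  by elim: e => // e' IH; rewrite iterSr iterS revS IH.
apply: (can_inj (iter_ordSK e)); rewrite iter_ord_predK.
by rewrite /= revSe rev_ordK.
Qed.

Lemma synthesizable_le N N' V : N <= N' -> synthesizable N V -> synthesizable N' V.
Proof. by move=> NN' [c [wf -> cN]]; exists c; split=> //; apply: le_trans NN'. Qed.

Lemma synthesizable_mul N N' V W :
  synthesizable N V -> synthesizable N' W -> synthesizable (N + N') (V *m W).
Proof.
move=> [c [wf -> cN]] [c' [wf' -> cN']]; exists (c ++ c').
by split; rewrite ?all_cat ?wf ?big_cat ?mulmxE// count_cat PoszD lerD.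
Qed.

Lemma synthesizable1 : synthesizable 0 (1%:M : qudit_op C n d).
Proof. by exists [::]; rewrite big_nil. Qed.

Lemma synthesizable_single k A :
  A \is unitarymx -> synthesizable 0 (blk k (fun=> A) : qudit_op C n d).
Proof.
move=> Au; exists [:: SingleGate k A]; split; rewrite /= ?Au//.
by rewrite big_seq1 /= -tens1E.
Qed.

Lemma synthesizable_SUM i j :
  i != j -> synthesizable 1 (blk j (fun y => shiftX C d ^+ y i)).
Proof.
move=> ij; exists [:: SumGate C d i j]; split; rewrite /= ?ij//.
by rewrite big_seq1 /= SUM_blk.
Qed.

Lemma synthesizable_SUM_adj i j :
  i != j -> synthesizable 1 (blk j (fun y => (shiftX C d ^+ y i)^t*)).
Proof.
move=> ij; set P := fun_mx (@rev_ord d).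
have Pu : P \is unitarymx by apply: fun_mx_unitary (@rev_ordK d) (@rev_ordK d).
have -> : blk j (fun y => (shiftX C d ^+ y i)^t*) = blk j (fun=> P)
    *m blk j (fun y => shiftX C d ^+ y i) *m blk j (fun=> P).
  rewrite !blk_mul //; first by apply: eq_blk => y; rewrite shiftX_adj.
  by move=> y b; rewrite upd_other.
rewrite -[1]add0r -[0 + 1]addr0.
apply: synthesizable_mul; last exact: synthesizable_single.
by apply: synthesizable_mul (synthesizable_single _ _) (synthesizable_SUM _).
Qed.

Lemma gate_adj (g : gate C n d) :
  gate_wf g -> synthesizable (is_sum g)%:Z ((gate_op g)^t*).
Proof.
case: g => [k A|i j] /=.
  move=> Au; rewrite /on_qudit tens1E blk_adj//.
  by apply: synthesizable_single; rewrite trmxC_unitary.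
move=> ij; rewrite SUM_blk// blk_adj; first exact: synthesizable_SUM_adj.
by move=> y b; rewrite upd_other.
Qed.

Lemma synthesizable_adj N V : synthesizable N V -> synthesizable N (V^t*).
Proof.
move=> [c [wf -> cN]]; apply: synthesizable_le cN _.
elim: c wf => [|g c IH] /=; first by rewrite big_nil -idmxE trmxC1 => _; exact: synthesizable1.
move=> /andP[gw cw]; rewrite big_cons -mulmxE trmxCM PoszD addrC.
exact: synthesizable_mul (IH cw) (gate_adj gw).
Qed.

Lemma blk_unitary k M : indep k M -> (forall y, M y \is unitarymx) ->
  blk k M \is unitarymx.
Proof.
move=> Mk Mu; apply/unitarymxP; rewrite blk_adj// blk_mul// -(blk1 _ _ k).
by apply: eq_blk => y; apply/unitarymxP.
Qed.

Lemma synthesizable_unitary N V : synthesizable N V -> V \is unitarymx.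
Proof.
move=> [c [+ -> _]]; elim: c => [|g c IH] /=.
  by rewrite big_nil -idmxE => _; apply/unitarymxP; rewrite trmxC1 mulmx1.
move=> /andP[gw cw]; rewrite big_cons -mulmxE mul_unitarymx ?IH//.
case: g gw => [k A|i j] /= gw.
  by rewrite /on_qudit tens1E; apply: blk_unitary.
rewrite SUM_blk//; apply: blk_unitary => [y b|y]; first by rewrite upd_other.
exact: shiftX_unitary.
Qed.

(** A map of labels up to phases. The phases stay hidden because conjugation of diagonal operators
    does not see them. *)
Definition monomial (s : label n d -> label n d) V := exists phi : label n d -> C,
  V = \matrix_(p, q) ((basis_label p == s (basis_label q))%:R * phi (basis_label q)).

Definition diag_op (phi : label n d -> C) : qudit_op C n d :=
  \matrix_(p, q) ((basis_label p == basis_label q)%:R * phi (basis_label q)).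

Lemma eq_diag_op phi psi : phi =1 psi -> diag_op phi = diag_op psi.
Proof. by move=> e; apply/matrixP => p q; rewrite !mxE e. Qed.

(** Column y of [V] can be nonzero only at row [s y], so a diagonal operator on the left multiplies
    that column by [beta (s y)], whatever its phase. For unitary [V] this determines V^* D V. *)
Lemma monomial_diag_op s V beta : monomial s V ->
  V *m diag_op (beta \o s) = diag_op beta *m V.
Proof.
move=> [phi ->]; apply/matrixP => p q; rewrite !mxE.
set x := basis_label p; set z := basis_label q.
under eq_bigr do rewrite !mxE -/x -/z.
under [RHS]eq_bigr do rewrite !mxE -/x -/z.
rewrite (sum_basis_label (fun y : label n d => (x == s y)%:R * phi y *
  ((y == z)%:R * beta (s z)))).
rewrite (sum_basis_label (fun y : label n d => (x == y)%:R * beta y *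
  ((y == s z)%:R * phi z))).
rewrite (bigD1 z) //= big1 ?addr0 => [|y /negPf->]; last by rewrite mul0r mulr0.
rewrite (bigD1 (s z)) //= big1 ?addr0 => [|y /negPf->]; last by rewrite mul0r mulr0.
by rewrite !eqxx !mul1r -!mulrA; congr (_ * _); rewrite mulrC.
Qed.

Lemma monomial_mul s s' V W : monomial s V -> monomial s' W ->
  monomial (s \o s') (V *m W).
Proof.
move=> [phi ->] [psi ->]; exists (fun y => phi (s' y) * psi y).
apply/matrixP => p q; rewrite !mxE.
set x := basis_label p; set z := basis_label q.
under eq_bigr do rewrite !mxE -/x -/z.
rewrite (sum_basis_label (fun y : label n d => (x == s y)%:R * phi y *
  ((y == s' z)%:R * psi z))).
rewrite (bigD1 (s' z)) //= big1 ?addr0 => [|y /negPf->]; last by rewrite mul0r mulr0.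
by rewrite !eqxx !mul1r -!mulrA.
Qed.

Lemma monomial_blk k M (f : label n d -> 'I_d -> 'I_d) :
  (forall y a b, a != f y b -> M y a b = 0) ->
  monomial (fun y => upd y k (f y (y k))) (blk k M).
Proof.
move=> Mf; exists (fun y => M y (f y (y k)) (y k)).
apply/matrixP => p q; rewrite !mxE.
set x := basis_label p; set z := basis_label q.
have [xk|xk] := eqVneq (x k) (f z (z k)); first by rewrite xk.
rewrite Mf// mulr0; case: eqP => [e|_]; last by rewrite mul0r.
by rewrite e upd_same eqxx in xk.
Qed.

(** A diagonal operator belongs to no particular qudit: any [t] may be taken as the one it acts on.
    This lets phases migrate from the target to a control. *)
Lemma diag_op_blk t (phi : label n d -> 'I_d -> C) :
  diag_op (fun y => phi y (y t)) = blk t (fun y => diag_mx (\row_b phi y b)).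
Proof.
apply/matrixP => p q; rewrite !mxE.
set x := basis_label p; set z := basis_label q.
have [xt|xt] := eqVneq (x t) (z t); first by rewrite xt upd_id mulr1n.
by case: eqP => [e|_]; rewrite ?mul0r ?mulr0n ?mulr0 //; rewrite e eqxx in xt.
Qed.

End Circuits.

(** * Single-qudit matrices: diagonalization and commutators *)

Section SingleQudit.
Variables (C : numClosedFieldType) (d : nat).
Implicit Types (A B Q U : 'M[C]_d) (delta alpha : 'I_d -> C).

Definition diagm delta : 'M[C]_d := diag_mx (\row_b delta b).

Lemma diagm_adj delta : (diagm delta)^t* = diagm (fun b => (delta b)^*).
Proof.
apply/matrixP => a b; rewrite !mxE eq_sym.
by case: eqP => [->|_]; rewrite ?mulr1n ?mulr0n ?rmorph0.
Qed.

Lemma diagmM delta alpha : diagm delta *m diagm alpha = diagm (fun b => delta b * alpha b).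
Proof.
by rewrite mulmx_diag; congr diag_mx; apply/rowP => b; rewrite !mxE.
Qed.

Lemma eq_diagm delta alpha : delta =1 alpha -> diagm delta = diagm alpha.
Proof. by move=> e; congr diag_mx; apply/rowP => b; rewrite !mxE. Qed.

Lemma diagm_const (z : C) : diagm (fun=> z) = z%:M.
Proof. by apply/matrixP => a b; rewrite !mxE. Qed.

Lemma det_diagm delta : \det (diagm delta) = \prod_b delta b.
Proof. by rewrite det_diag; apply: eq_bigr => b _; rewrite mxE. Qed.

Lemma norm1_conj (z : C) : `|z| = 1 -> z * z^* = 1.
Proof. by move=> z1; rewrite -normCK z1 expr1n. Qed.

Lemma diagm_unitaryP delta : reflect (forall b, `|delta b| = 1) (diagm delta \is unitarymx).
Proof.
apply: (iffP unitarymxP); rewrite diagm_adj diagmM => H.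
  move=> b; move/matrixP: H => /(_ b b); rewrite !mxE eqxx mulr1n => H.
  by apply/eqP; rewrite -sqrp_eq1// normCK H.
by rewrite -diagm_const; apply: eq_diagm => b; apply: norm1_conj.
Qed.

Lemma det_unitary_conj Q A : Q \is unitarymx -> \det (Q^t* *m A *m Q) = \det A.
Proof.
move=> Qu; rewrite !det_mulmx mulrC mulrA -det_mulmx.
by rewrite (unitarymxP Qu) det1 mul1r.
Qed.

Lemma unitary_diagonalizable U : U \is unitarymx ->
  exists Q delta, [/\ Q \is unitarymx, forall b, `|delta b| = 1
    & U = Q^t* *m diagm delta *m Q].
Proof.
move=> Uu; have Un : U \is normalmx.
  by apply/normalmxP; rewrite unitary_adjmulK// (unitarymxP Uu).
have Qu := spectral_unitarymx U; set Q := spectralmx U in Qu.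
have UE : U = Q^t* *m diagm (fun b => spectral_diag U 0 b) *m Q.
  have /orthomx_spectralP {1}-> := Un; rewrite invmx_unitary//.
  by congr (_ *m _ *m _); congr diag_mx; apply/rowP => b; rewrite mxE.
exists Q, (fun b => spectral_diag U 0 b); split=> //; apply/diagm_unitaryP.
have -> : diagm (fun b => spectral_diag U 0 b) = Q *m U *m Q^t*.
  by rewrite [X in _ *m X *m _]UE !mulmxA (unitarymxP Qu) mul1mx -mulmxA
     (unitarymxP Qu) mulmx1.
by rewrite !mul_unitarymx// trmxC_unitary.
Qed.

Lemma norm_det_unitary U : U \is unitarymx -> `|\det U| = 1.
Proof.
move=> /unitarymxP/(congr1 determinant); rewrite det_mulmx det1 det_map_mx det_tr.
by move=> H; apply/eqP; rewrite -sqrp_eq1// normCK H.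
Qed.

Lemma scale_unitary (z : C) U : `|z| = 1 -> U \is unitarymx -> z *: U \is unitarymx.
Proof.
move=> z1 Uu; rewrite -mul_scalar_mx mul_unitarymx// -diagm_const.
by apply/diagm_unitaryP.
Qed.

Hypothesis d_gt0 : (0 < d)%N.

Lemma norm_rootC1 (z : C) : `|z| = 1 -> `|d.-root z| = 1.
Proof. by move=> z1; rewrite norm_rootC z1 rootC1. Qed.

Lemma scale_det1 U : U \is unitarymx -> exists z : C, `|z| = 1 /\ \det (z *: U) = 1.
Proof.
move=> Uu; have U1 := norm_det_unitary Uu.
exists (d.-root (\det U))^-1; rewrite normfV norm_rootC1// invr1; split=> //.
rewrite detZ exprVn rootCK// mulVf//.
by rewrite -normr_eq0 U1 oner_eq0.
Qed.

(** [alpha b] is the partial product of [delta c] over c < b. At b = d - 1 the successor wraps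
    around to 0, where the total product 1 closes the cycle. *)
Lemma prod1_coboundary delta : (forall b, `|delta b| = 1) -> \prod_b delta b = 1 ->
  exists alpha, (forall b, `|alpha b| = 1)
    /\ forall b, delta b = alpha (ordS b) * (alpha b)^*.
Proof.
move=> delta1 prod1.
have alpha1 (b : nat) : `|\prod_(c < d | (c < b)%N) delta c| = 1.
  by rewrite normr_prod big1.
exists (fun b : 'I_d => \prod_(c < d | (c < b)%N) delta c).
split=> [b|b]; first exact: alpha1.
have step : \prod_(c < d | (c <= b)%N) delta c = delta b * \prod_(c < d | (c < b)%N) delta c.
  rewrite (bigD1 b) //=; congr (_ * _); apply: eq_bigl => c.
  by rewrite ltn_neqAle andbC.
have -> : \prod_(c < d | (c < ordS b)%N) delta c = \prod_(c < d | (c <= b)%N) delta c.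
  rewrite /=; have := ltn_ord b; rewrite leq_eqVlt => /orP[/eqP bd|bd]; last first.
    by rewrite modn_small.
  rewrite bd modnn big_pred0 // -[LHS]prod1; apply: eq_bigl => c.
  by have := ltn_ord c; rewrite -[X in (_ < X)%N]bd ltnS => ->.
by rewrite step -mulrA norm1_conj ?mulr1.
Qed.

Lemma shift_conj alpha :
  (shiftX C d)^t* *m diagm alpha *m shiftX C d = diagm (fun b => alpha (ordS b)).
Proof.
have XE : shiftX C d = fun_mx C (@ordS d) by apply/matrixP => a b; rewrite !mxE.
rewrite {1}XE (fun_mx_adj C (@ordSK d) (@ord_predK d)) XE.
apply/matrixP => a b; rewrite mul_mx_diag !mxE (bigD1 (ordS b)) //= !mxE.
rewrite eqxx mulr1 ordSK big1 ?addr0 => [|c /negPf cb]; last by rewrite !mxE cb mulr0.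
by case: eqP => [->|_]; rewrite ?mul1r ?mulr1n ?mul0r ?mulr0n.
Qed.

(** In an eigenbasis of [U], the commutator of X^* and a diagonal matrix has the entries alpha (b +
    1) alpha (b)^*, so the coboundary lemma applies. Rescaling both matrices to determinant 1 leaves
    the commutator unchanged, as unit scalars cancel in it. *)
Lemma SU_commutator U : U \is unitarymx -> \det U = 1 ->
  exists A B, [/\ A \is unitarymx /\ \det A = 1, B \is unitarymx /\ \det B = 1
    & U = A *m B *m A^t* *m B^t*].
Proof.
move=> Uu detU; have [Q [delta [Qu delta1 UE]]] := unitary_diagonalizable Uu.
have prod1 : \prod_b delta b = 1.
  by rewrite -det_diagm -detU UE det_unitary_conj.
have [alpha [alpha1 deltaE]] := prod1_coboundary delta1 prod1.
have Xu : (shiftX C d)^t* \is unitarymx by rewrite trmxC_unitary (shiftX_unitary C d 1).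
have Du : diagm alpha \is unitarymx by apply/diagm_unitaryP.
have [z [z1 detA]] := scale_det1 Xu; have [w [w1 detB]] := scale_det1 Du.
pose cj A := Q^t* *m A *m Q.
have conjM A B : cj A *m cj B = cj (A *m B).
  by rewrite /cj !mulmxA -[_ *m Q *m Q^t*]mulmxA (unitarymxP Qu) mulmx1.
have conj_adj A : (cj A)^t* = cj (A^t*).
  by rewrite /cj !trmxCM trmxCK mulmxA.
have conj_u A : A \is unitarymx -> cj A \is unitarymx.
  by move=> Au; rewrite !mul_unitarymx// trmxC_unitary.
have conj_det A : \det (cj A) = \det A.
  rewrite !det_mulmx mulrC mulrA -det_mulmx.
  by rewrite (unitarymxP Qu) det1 mul1r.
exists (cj (z *: (shiftX C d)^t*)), (cj (w *: diagm alpha)).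
rewrite !conj_u ?scale_unitary// !conj_det; split=> //.
rewrite !conj_adj !conjM UE; congr (cj _).
have adjZ (c : C) A : (c *: A)^t* = c^* *: A^t*.
  by apply/matrixP => a b; rewrite !mxE rmorphM.
rewrite !adjZ trmxCK !(=^~ scalemxAl, =^~ scalemxAr) !scalerA.
rewrite shift_conj diagm_adj diagmM.
rewrite mulrAC [w^* * w]mulrC norm1_conj// mul1r norm1_conj// scale1r.
by apply: eq_diagm => b; rewrite deltaE.
Qed.

(** A power of a monomial matrix follows the orbit of [b] under [f] and collects the factors met on
    the way. *)
Lemma fun_mx_diagm_exp (f : 'I_d -> 'I_d) alpha m a b :
  ((fun_mx C f *m diagm alpha) ^+ m) a b
  = (a == iter m f b)%:R * \prod_(j < m) alpha (iter j f b).
Proof.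
elim: m a b => [|m IH] a b; first by rewrite expr0 -idmxE big_ord0 mulr1 mxE.
rewrite exprSr -mulmxE mulmxA mul_mx_diag !mxE (bigD1 (f b)) //= !mxE.
rewrite big1 ?addr0 => [|c /negPf cb]; last by rewrite !mxE cb mulr0.
rewrite IH eqxx mulr1 -iterSr -mulrA; congr (_ * _).
rewrite big_ord_recl mulrC; congr (_ * _); apply: eq_bigr => j _.
by rewrite /= -iterSr.
Qed.

End SingleQudit.

(** * One control, and controlled scalars *)

Section SinglyControlled.
Variables (C : numClosedFieldType) (n d : nat).
Hypothesis d_prime : prime d.
Implicit Types (y : label n d) (x t : 'I_n) (S : seq 'I_n) (N : int).
Implicit Types (A U Q : 'M[C]_d) (delta alpha : 'I_d -> C).

Let d_gt0 : (0 < d)%N := prime_gt0 d_prime.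

Lemma iter_ordS_full (b : 'I_d) : iter d (@ordS d) b = b.
Proof. by apply: val_inj; rewrite /= val_iter_ordS modnDr modn_small. Qed.

Lemma iter_iter_ordS j e (b : 'I_d) :
  iter j (iter e (@ordS d)) b = ((b + j * e) %% d)%N :> nat.
Proof. by rewrite -iterM val_iter_ordS. Qed.

(** As d is prime, e generates Z/d, so d steps of length e visit every value once. *)
Lemma prod_iter_ordS alpha e (b : 'I_d) : (0 < e < d)%N ->
  \prod_(j < d) alpha (iter j (iter e (@ordS d)) b) = \prod_c alpha c.
Proof.
move=> /andP[e0 ed]; apply/esym.
suff inj : injective (fun j : 'I_d => iter j (iter e (@ordS d)) b).
  by rewrite (reindex_inj inj).
move=> j1 j2 /(congr1 (@nat_of_ord d)); rewrite !iter_iter_ordS => /eqP.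
rewrite eqn_modDl => /eqP H; apply: val_inj => /=.
wlog le12 : j1 j2 H / (j1 <= j2)%N.
  by move=> W; case/orP: (leq_total j1 j2) => /W ->.
move/esym/eqP: H; rewrite eqn_mod_dvd ?leq_mul2r ?le12 ?orbT// -mulnBl Euclid_dvdM//.
have ltd : (j2 - j1 < d)%N by rewrite (leq_ltn_trans (leq_subr _ _)).
case/orP=> /dvdn_leq; last by move/(_ e0); rewrite leqNgt ed.
move=> H'; apply/eqP; rewrite eqn_leq le12 /= leqNgt -subn_gt0.
by apply/negP => /H'; rewrite leqNgt ltd.
Qed.

Lemma synthesizable_exp N t (M : label n d -> 'M[C]_d) m : indep t M ->
  synthesizable N (blk t M) -> synthesizable (m%:Z * N) (blk t (fun y => M y ^+ m)).
Proof.
move=> Mt MN; elim: m => [|m IH].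
  rewrite mul0r (eq_blk t (N := fun=> 1%:M)) ?blk1 => [|y]; first exact: synthesizable1.
  by rewrite expr0 idmxE.
rewrite (eq_blk t (N := fun y => M y *m M y ^+ m)) => [|y]; last by rewrite exprS mulmxE.
by rewrite -blk_mul// -addn1 PoszD addrC mulrDl mul1r; apply: synthesizable_mul.
Qed.

Lemma synthesizable_conj N t (M : label n d -> 'M[C]_d) Q :
  Q \is unitarymx -> indep t M -> synthesizable N (blk t M) ->
  synthesizable N (blk t (fun y => Q^t* *m M y *m Q)).
Proof.
move=> Qu Mt MN; have H (A B : 'M[C]_d) : A \is unitarymx -> B \is unitarymx ->
    synthesizable N (blk t (fun y => A *m M y *m B)).
  move=> Au Bu; have -> : blk t (fun y => A *m M y *m B)
      = blk t (fun=> A) *m blk t M *m blk t (fun=> B).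
    by rewrite !blk_mul // => y b; rewrite Mt.
  rewrite -[N]add0r -[0 + N]addr0; apply: synthesizable_mul.
    exact: synthesizable_mul (synthesizable_single _ _) _.
  exact: synthesizable_single.
by apply: H; rewrite ?trmxC_unitary.
Qed.

Lemma synthesizable_ctl_conj N S t A Q :
  Q \is unitarymx -> t \notin S -> synthesizable N (ctl S t A) ->
  synthesizable N (ctl S t (Q^t* *m A *m Q)).
Proof.
move=> Qu tS H; have := synthesizable_conj Qu (indep_ctl A 1%:M tS) H.
rewrite (eq_blk t (N := fun y => if on S y then Q^t* *m A *m Q else 1%:M))// => y.
by case: ifP => // _; rewrite mulmx1 unitary_adjmulK.
Qed.

(** Phase kickback: both sides multiply the basis vector of y by [phi (y x)]. *)
Lemma blk_phase x t (phi : 'I_d -> C) :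
  blk t (fun y => (phi (y x))%:M) = blk x (fun=> diagm phi) :> qudit_op C n d.
Proof.
transitivity (diag_op (fun y => phi (y x))); last exact: (diag_op_blk x (fun=> phi)).
rewrite (_ : diag_op _ = diag_op (fun y => (fun y (b : 'I_d) => phi (y x)) y (y t)))//.
rewrite (diag_op_blk t (fun y (b : 'I_d) => phi (y x))).
by apply: eq_blk => y; rewrite -[diag_mx _]/(diagm (fun=> phi (y x))) diagm_const.
Qed.

(* If X is the shift and e is the value of the control plus 1, then (X^e A)^d is
   A^d for e = d and the scalar det A otherwise, as X^e is then a d-cycle. *)
Lemma synthesizable_ctl1 x t U : x != t -> U \is unitarymx ->
  synthesizable d%:Z (ctl [:: x] t U).
Proof.
move=> xt Uu; have tx : t \notin [:: x] by rewrite inE eq_sym.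
have [Q [delta [Qu delta1 ->]]] := unitary_diagonalizable Uu.
apply: synthesizable_ctl_conj => //.
(* A d-th root, because the d-th power of [diagm alpha] is what reaches the target when the control
   is on. *)
pose alpha b := d.-root (delta b).
have alpha1 b : `|alpha b| = 1 by rewrite norm_rootC1.
pose z := \prod_b alpha b.
have z1 : `|z| = 1 by rewrite normr_prod big1.
(* The exponent is offset by one so that the control value d - 1 gives X^d = 1. *)
pose M y := shiftX C d ^+ (y x).+1 *m diagm alpha.
have Mt : indep t M by move=> y b; rewrite /M upd_other.
have MN : synthesizable 1 (blk t M).
  rewrite (eq_blk t (N := fun y => shiftX C d ^+ y x *m (shiftX C d *m diagm alpha))).
    rewrite -blk_mul => [|y b]; last by rewrite upd_other.
    rewrite -[1]addr0; apply: synthesizable_mul; first exact: synthesizable_SUM.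
    apply: synthesizable_single; rewrite mul_unitarymx//.
      exact: (shiftX_unitary C d 1).
    exact/diagm_unitaryP.
  by move=> y; rewrite /M exprSr -mulmxE mulmxA.
(* For the other control values the power is the scalar [z]; its inverse, a phase on the control
   alone, costs no SUM gate. *)
pose phi (b : 'I_d) := if b == d.-1 :> nat then 1 else z^*.
have -> : ctl [:: x] t (diagm delta)
    = blk t (fun y => M y ^+ d) *m blk t (fun y => (phi (y x))%:M).
  rewrite blk_mul => [|y b]; last by rewrite Mt.
  apply: eq_blk => y; rewrite /on /= andbT /phi.
  have ME : M y = fun_mx C (iter (y x).+1 (@ordS d)) *m diagm alpha.
    by rewrite /M shiftXE.
  apply/matrixP => a b; case: eqP => [yx|yx].
    rewrite mulmx1 ME.
    rewrite (fun_mx_diagm_exp (C := C)) yx prednK//.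
    have iterE j : iter j (iter d (@ordS d)) b = b.
      by elim: j => //= j ->; apply: iter_ordS_full.
    rewrite iterE; under eq_bigr do rewrite iterE.
    rewrite prodr_const card_ord rootCK// !mxE.
    by case: eqP => [->|_]; rewrite ?mul1r ?mulr1n ?mul0r ?mulr0n.
  rewrite mul_mx_scalar [RHS]mxE ME (fun_mx_diagm_exp (C := C)) prod_iter_ordS; last first.
    by have := ltn_ord (y x); move: yx; lia.
  rewrite -/z mulrCA [z^* * z]mulrC norm1_conj// mulr1 mxE.
  congr (nat_of_bool (_ == _))%:R; apply: val_inj.
  by rewrite /= iter_iter_ordS addnC mulnC modnMDl modn_small.
rewrite blk_phase -[d%:Z]mulr1 -[d%:Z * 1]addr0.
apply: synthesizable_mul; first exact: synthesizable_exp.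
apply: synthesizable_single; apply/diagm_unitaryP => b; rewrite /phi.
by case: ifP; rewrite ?normr1 ?norm_conjC.
Qed.

(** A controlled scalar multiplies by [z] the basis states with all controls on, whichever qudit is
    called the target; so it can be realized on a control. *)
Lemma synthesizable_ctl_phase x S t (z : C) N :
  `|z| = 1 -> x \notin S -> t \notin x :: S ->
  synthesizable N (ctl S x (diagm (fun b : 'I_d => if b == d.-1 :> nat then z else 1))) ->
  synthesizable N (ctl (x :: S) t (z%:M : 'M[C]_d)).
Proof.
move=> z1 xS txS; congr (synthesizable N _).
pose phi y (b : 'I_d) := if on S y then (if b == d.-1 :> nat then z else 1) else 1.
transitivity (diag_op (fun y => phi y (y x))).
  rewrite diag_op_blk; apply: eq_blk => y; rewrite /phi -[diag_mx _]/(diagm _).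
  by case: ifP => // _; rewrite diagm_const.
(* [psi] ignores [b]: the same diagonal operator is now read as acting on [t]. *)
pose psi y (b : 'I_d) := phi y (y x).
rewrite -[diag_op _]/(diag_op (fun y => psi y (y t)))//.
rewrite diag_op_blk; apply: eq_blk => y.
rewrite -[diag_mx _]/(diagm (fun=> phi y (y x))) diagm_const /phi /=.
by case: (on S y); rewrite ?andbT ?andbF//; case: ifP.
Qed.

End SinglyControlled.

(** * Arithmetic of the recursive count *)

(** The formulas for k and k + 1 agree at c = 2^(k+1), so the one for k holds on the closed dyadic
    interval. *)
Lemma N_SU_rec_interval k c : (2 ^ k <= c <= 2 ^ k.+1)%N ->
  N_SU_rec c.+1 = 2 ^+ k * 2 ^+ k + 3 * 2 ^+ k * (c%:Z - 2 ^+ k).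
Proof.
have sq m : 2 ^+ (2 * m) = 2 ^+ m * 2 ^+ m :> int by rewrite -exprD mul2n addnn.
move=> /andP[kc]; rewrite leq_eqVlt => /orP[/eqP-> {kc c}|ck].
  rewrite /N_SU_rec /= trunc_expnK// sq !exprS intS.
  have -> : (2 ^ k.+1)%N%:Z = 2 * 2 ^+ k by rewrite expnS PoszM -[X in _ * X]natz natrX.
  by move: (2 ^+ k) => u; ring.
rewrite /N_SU_rec /= (@trunc_log_eq 2 k) ?kc// sq intS.
by congr (_ + _ * _); move: (2 ^+ k) => u; ring.
Qed.

(** For c between 2^(k+1) and 2^(k+2), both halves lie in the closed interval from 2^k to 2^(k+1),
    where the count is affine. *)
Lemma N_SU_rec_half c : (2 <= c)%N ->
  N_SU_rec c.+1 = 2 * N_SU_rec (c./2).+1 + 2 * N_SU_rec (c - c./2).+1.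
Proof.
move=> c2; have c0 : (0 < c)%N by lia.
have /andP[] := trunc_log_bounds (ltnSn 1) c0.
have : (1 <= trunc_log 2 c)%N by rewrite trunc_log_gt0; lia.
case: (trunc_log 2 c) => // k _ lo hi.
have E : (2 ^ k.+1 = 2 * 2 ^ k)%N by rewrite expnS.
have E' : (2 ^ k.+2 = 4 * 2 ^ k)%N by rewrite !expnS mulnA.
have B : (2 ^ k.+1 <= c <= 2 ^ k.+2)%N by rewrite lo (ltnW hi).
have B1 : (2 ^ k <= c./2 <= 2 ^ k.+1)%N.
  by move: lo hi; rewrite E E'; move: (2 ^ k)%N => u lo hi; lia.
have B2 : (2 ^ k <= c - c./2 <= 2 ^ k.+1)%N.
  by move: lo hi; rewrite E E'; move: (2 ^ k)%N => u lo hi; lia.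
rewrite (N_SU_rec_interval B) (N_SU_rec_interval B1) (N_SU_rec_interval B2).
have -> : c%:Z = (c./2)%:Z + (c - c./2)%N%:Z by lia.
rewrite !exprS; move: (2 ^+ k) (c./2)%:Z (c - c./2)%N%:Z => u v w; ring.
Qed.

(** * The Hadamard gate as a conjugate of the shift *)

Section Hadamard.
Variable C : numClosedFieldType.

Let mx2 (p q r s : C) : 'M[C]_2 :=
  \matrix_(i, j) if i == 0 then if j == 0 then p else q else if j == 0 then r else s.

Let mx2P (A B : 'M[C]_2) :
  A 0 0 = B 0 0 -> A 0 1 = B 0 1 -> A 1 0 = B 1 0 -> A 1 1 = B 1 1 -> A = B.
Proof.
move=> e00 e01 e10 e11; apply/matrixP => i j.
have I2 (k : 'I_2) : k = 0 \/ k = 1.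
  by case: k => [[|[|]]]// ?; [left|right]; apply: val_inj.
by case: (I2 i) => ->; case: (I2 j) => ->.
Qed.

Let mx2M p q r s p' q' r' s' : mx2 p q r s *m mx2 p' q' r' s' =
  mx2 (p * p' + q * r') (p * q' + q * s') (r * p' + s * r') (r * q' + s * s').
Proof. by apply: mx2P; rewrite !mxE big_ord_recl big_ord1 !mxE. Qed.

Let mx2_adj p q r s : (mx2 p q r s)^t* = mx2 p^* r^* q^* s^*.
Proof. by apply: mx2P; rewrite !mxE. Qed.

(* Writing s = cos phi and c = sin phi, the reflection K conjugates X to the
   Hadamard gate when tan (2 phi) = - 1. *)
Lemma hadamard_conj_shift : exists (K : 'M[C]_2) gamma, K \is unitarymx /\
  (K^t* *m shiftX C 2 *m K) *m shiftX C 2 *m (K^t* *m shiftX C 2 *m K)^t* = diagm gamma.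
Proof.
(* [u] is the cotangent of phi = 3 pi / 8, the positive root of u^2 + 2 u = 1; below, [v] normalizes
   (u, 1) to the unit vector (s, c). *)
pose u : C := sqrtC 2 - 1.
have u_real : u^* = u.
  by apply: conj_Creal; rewrite rpredB// ?rpred1// ger0_real// sqrtC_ge0 ler0n.
have u2 : u * u = 1 - 2 * u.
  by rewrite /u mulrBl !mulrBr -expr2 sqrtCK; ring.
pose v : C := sqrtC (1 + u * u).
have uu0 : 0 <= u * u by rewrite -{2}u_real mul_conjC_ge0.
have v_real : v^* = v.
  by apply: conj_Creal; rewrite ger0_real// sqrtC_ge0 addr_ge0 ?ler01.
have v2 : v * v = 2 - 2 * u by rewrite -expr2 sqrtCK u2; ring.
have v0 : v != 0.
  by rewrite sqrtC_eq0 paddr_eq0 ?ler01// oner_eq0.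
pose c := v^-1.
have c_real : c^* = c by rewrite /c fmorphV /= v_real.
have c2 : c * c * (2 - 2 * u) = 1 by rewrite -v2 mulrACA mulVf// mulr1.
pose s := u * c.
have s_real : s^* = s by rewrite rmorphM /= u_real c_real.
have norm : s * s + c * c = 1 by rewrite -c2 /s mulrACA u2; ring.
(* This is tan (2 phi) = - 1; it makes the entries of K X K equal up to sign. *)
have bal : s * c + s * c = c * c - s * s by rewrite /s mulrACA u2; ring.
pose K := mx2 s c c (- s).
have Kadj : K^t* = K by rewrite mx2_adj rmorphN /= s_real c_real.
have XE : shiftX C 2 = mx2 0 1 1 0 by apply: mx2P; rewrite !mxE.
pose r := s * c + s * c.
have r_real : r^* = r by rewrite rmorphD rmorphM /= s_real c_real.
have HE : K^t* *m shiftX C 2 *m K = mx2 r r r (- r).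
  rewrite Kadj XE !mx2M; congr mx2; rewrite /r; try ring.
    by rewrite bal; ring.
  by rewrite bal; ring.
exists K, (fun i => if i == 0 then 2 * r * r else - (2 * r * r)); split.
  apply/unitarymxP; rewrite Kadj mx2M; apply: mx2P; rewrite !mxE /= ?norm //.
  - by ring.
  - by ring.
  - by rewrite -norm; ring.
rewrite HE XE mx2_adj rmorphN /= r_real !mx2M.
by apply: mx2P; rewrite !mxE /= ?mulr1n ?mulr0n; ring.
Qed.

End Hadamard.

(** * Commutators over split controls *)

Section LinearCost.
Variables (C : numClosedFieldType) (n d : nat).
Hypothesis d_prime : prime d.
Implicit Types (y : label n d) (x a t : 'I_n) (S : seq 'I_n) (N : int).
Implicit Types (A U Q : 'M[C]_d) (delta alpha : 'I_d -> C).

Let d_gt0 : (0 < d)%N := prime_gt0 d_prime.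

(** When one of the two lists of controls is off, its matrix becomes 1 and the commutator collapses
    to 1. *)
Lemma synthesizable_commutator S1 S2 t A U N1 N2 :
  A \is unitarymx -> U \is unitarymx -> t \notin S1 -> t \notin S2 ->
  synthesizable N1 (ctl S1 t A) -> synthesizable N2 (ctl S2 t U) ->
  synthesizable (2 * N1 + 2 * N2) (ctl (S1 ++ S2) t (A *m U *m A^t* *m U^t*)).
Proof.
move=> Au Uu tS1 tS2 H1 H2.
have -> : ctl (S1 ++ S2) t (A *m U *m A^t* *m U^t*)
    = ctl S1 t A *m ctl S2 t U *m (ctl S1 t A)^t* *m (ctl S2 t U)^t*.
  rewrite !ctl_adj// {2 3 4 5}/ctl -!mulmxA !blk_mul; try exact: indep_ctl.
  apply: eq_blk => y; rewrite /on all_cat -!/(on _ y).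
  case: (on S1 y); case: (on S2 y); rewrite ?mulmx1 ?mul1mx ?mulmxA //.
    by rewrite (unitarymxP Au).
  by rewrite (unitarymxP Uu).
have -> : 2 * N1 + 2 * N2 = N1 + N2 + N1 + N2 by lia.
by do 3?[apply: synthesizable_mul]; rewrite ?H1 ?H2//; apply: synthesizable_adj.
Qed.

Lemma synthesizable_ctl_rec S t U : (0 < size S)%N -> t \notin S ->
  U \is unitarymx -> \det U = 1 ->
  synthesizable (d%:Z * N_SU_rec (size S).+1) (ctl S t U).
Proof.
have [c] := ubnP (size S); elim: c S U => // c IH S U Sc S0 tS Uu detU.
case: (ltnP 1 (size S)) => S1; last first.
  case: S S1 S0 tS {Sc} => [|x [|]]//= _ _ tx.
  (* At m = 2 the formula still evaluates, to 1, which matches the d SUM gates of a single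
     control. *)
  rewrite (_ : N_SU_rec 2 = 1) ?mulr1; first apply: synthesizable_ctl1 => //.
    by rewrite inE eq_sym in tx.
  by rewrite /N_SU_rec /= trunc_log1.
have [A [B [[Au detA] [Bu detB] ->]]] := SU_commutator d_gt0 Uu detU.
set h := (size S)./2.
have szt : size (take h S) = h by rewrite size_take /h; case: ltnP; lia.
have szd : size (drop h S) = (size S - h)%N by rewrite size_drop.
rewrite N_SU_rec_half// -/h -[in ctl _ _ _](cat_take_drop h S) mulrDr !(mulrCA d%:Z).
have tt : t \notin take h S by apply: contra tS; apply: mem_take.
have td : t \notin drop h S by apply: contra tS; apply: mem_drop.
apply: synthesizable_commutator => //.
  by have := IH (take h S) A; rewrite szt; apply=> //; rewrite /h; lia.
by have := IH (drop h S) B; rewrite szd; apply=> //; rewrite /h; lia.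
Qed.

(** The price in SUM gates of a controlled change to an eigenbasis of X. *)
Definition cost_W : int := if d == 2 then 1 else d%:Z.

(* For d = 2, Q is the Hadamard gate, which is conjugate to the shift. *)
Lemma cheap_shift_diagonalizer : exists Q gamma,
  [/\ Q \is unitarymx, Q *m shiftX C d *m Q^t* = diagm gamma
    & forall x t, x != t -> synthesizable cost_W (ctl [:: x] t (Q^t*))].
Proof.
rewrite /cost_W; case: eqP => d2; last first.
  have [Q [gamma [Qu _ XE]]] := unitary_diagonalizable (shiftX_unitary C d 1).
  exists Q, gamma; split=> //.
    rewrite -[shiftX C d]expr1 XE !mulmxA (unitarymxP Qu) mul1mx -mulmxA.
    by rewrite (unitarymxP Qu) mulmx1.
  by move=> x t xt; apply: synthesizable_ctl1; rewrite ?trmxC_unitary.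
(* For qubits SUM is the controlled X, so a controlled conjugate of X costs one SUM gate. It remains
   to find a conjugate of X that diagonalizes X. *)
suff [K [gamma [Ku KE]]] : exists K gamma, K \is unitarymx /\
    (K^t* *m shiftX C d *m K) *m shiftX C d *m (K^t* *m shiftX C d *m K)^t* = diagm gamma.
  have Xu := shiftX_unitary C d 1.
  exists (K^t* *m shiftX C d *m K), gamma; split=> //.
    by rewrite !mul_unitarymx ?trmxC_unitary.
  move=> x t xt; have tx : t \notin [:: x] by rewrite inE eq_sym.
  rewrite !trmxCM trmxCK mulmxA.
  apply: synthesizable_ctl_conj => //; rewrite -ctl_adj//; apply: synthesizable_adj.
  have -> : ctl [:: x] t (shiftX C d) = blk t (fun y => shiftX C d ^+ y x).
    apply: eq_blk => y; rewrite /on /= andbT.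
    have -> : d.-1 = 1%N by rewrite d2.
    have : (y x < 2)%N by rewrite -[X in (_ < X)%N]d2.
    by case: (y x : nat) => [|[|]]//; rewrite idmxE.
  exact: synthesizable_SUM.
suff W m : m = 2%N -> exists (K : 'M[C]_m) gamma, K \is unitarymx /\
    (K^t* *m shiftX C m *m K) *m shiftX C m *m (K^t* *m shiftX C m *m K)^t* = diagm gamma.
  exact: W d2.
by move=> ->; apply: hadamard_conj_shift.
Qed.

End LinearCost.

(** * The ladder on dirty ancillas *)

Section Ladder.
Variables (C : numClosedFieldType) (n d : nat).
Hypothesis d_prime : prime d.
Implicit Types (y : label n d) (x a t : 'I_n) (S : seq 'I_n) (N : int).
Implicit Types (A U Q : 'M[C]_d) (delta alpha : 'I_d -> C).

Let d_gt0 : (0 < d)%N := prime_gt0 d_prime.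

Local Notation w := (cost_W d).

Definition toff_fun x a y : 'I_d -> 'I_d :=
  fun b => if y x == d.-1 :> nat then iter (y a) (@ordS d) b else b.

Definition toff_inv x a y : 'I_d -> 'I_d :=
  fun b => if y x == d.-1 :> nat then iter (y a) (@ord_pred d) b else b.

(* A relative-phase version of |x, a, t> |-> |x, a, t + a [x = d - 1]>: the shift
   X^a of t is conjugated, when x <> d - 1, by a unitary diagonalizing X. *)
Lemma relative_phase_gate x a t : x != t -> a != t -> exists F : qudit_op C n d,
  [/\ synthesizable (2 * w + 1) F,
      monomial (fun y => upd y t (toff_fun x a y (y t))) F
    & monomial (fun y => upd y t (toff_inv x a y (y t))) (F^t*)].
Proof.
move=> xt at_; have tx : t \notin [:: x] by rewrite inE eq_sym.
have [Q [gamma [Qu QX cheap]]] := cheap_shift_diagonalizer C n d_prime.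
(* [Q] is applied unconditionally, and a controlled [Q^*] undoes it when the control is on. *)
pose W y : 'M[C]_d := if y x == d.-1 :> nat then 1%:M else Q.
have Wt : indep t W by move=> y b; rewrite /W upd_other.
have Wc : synthesizable w (blk t W).
  have -> : blk t W = ctl [:: x] t (Q^t*) *m blk t (fun=> Q).
    rewrite blk_mul; last exact: indep_ctl.
    apply: eq_blk => y; rewrite /W /on /= andbT.
    by case: ifP; rewrite ?mul1mx ?unitary_adjmulK.
  rewrite -[w]addr0; apply: synthesizable_mul; first exact: cheap.
  exact: synthesizable_single.
pose M y := W y *m shiftX C d ^+ y a *m (W y)^t*.
have Mt : indep t M by move=> y b; rewrite /M Wt upd_other.
have ME y p q : p != toff_fun x a y q -> M y p q = 0.
  rewrite /M /W /toff_fun; case: ifP => _.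
    by rewrite trmxC1 mulmx1 mul1mx shiftXE mxE => /negPf->.
  (* With the control off, conjugation by [Q] makes the shift diagonal: labels stay put and only
     phases appear. *)
  move=> pq; have -> : Q *m shiftX C d ^+ y a *m Q^t* = diagm (fun b => gamma b ^+ y a).
    elim: (nat_of_ord (y a)) => [|e IH].
      by rewrite expr0 -idmxE mulmx1 (unitarymxP Qu) -diagm_const; apply: eq_diagm.
    rewrite exprS -mulmxE.
    transitivity ((Q *m shiftX C d *m Q^t*) *m (Q *m shiftX C d ^+ e *m Q^t*)).
      by rewrite !mulmxA -[_ *m Q^t* *m Q]mulmxA unitary_adjmulK// mulmx1.
    by rewrite QX IH diagmM; apply: eq_diagm => b; rewrite exprS.
  by rewrite !mxE (negPf pq) mulr0n.
exists (blk t M); split; last 2 first.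
- exact: monomial_blk.
- rewrite blk_adj//; apply: monomial_blk => y p q pq; rewrite mxE mxE ME ?rmorph0//.
  apply: contraNneq pq => ->; rewrite /toff_fun /toff_inv.
  by case: (_ == d.-1) => //; rewrite iter_ordSK.
have -> : blk t M = blk t W *m blk t (fun y => shiftX C d ^+ y a) *m (blk t W)^t*.
  by rewrite blk_adj// !blk_mul// => y b; rewrite ?Wt ?upd_other.
have -> : 2 * w + 1 = w + 1 + w by lia.
apply: synthesizable_mul (synthesizable_adj Wc).
by apply: synthesizable_mul => //; apply: synthesizable_SUM.
Qed.

(** [p] is a control with the target, [s] pairs the other controls with ancillas. The shorter ladder
    adds 1 to the ancilla [q.2] when the remaining controls are on. Conjugating it by F subtracts
    the old value of that ancilla from the target and adds the new one, provided [x] is on; so the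
    initial value is irrelevant. Final values of the ancillas are left open. *)
Lemma ladder (p : 'I_n * 'I_n) s :
  uniq (unzip1 (p :: s) ++ unzip2 (p :: s)) ->
  exists (V : qudit_op C n d) sigma,
  [/\ synthesizable (2 * (2 * w + 1) * (size s)%:Z + d%:Z) V, monomial sigma V,
      forall y l, l \notin unzip2 (p :: s) -> sigma y l = y l
    & forall y, sigma y p.2 = if on (unzip1 (p :: s)) y then ordS (y p.2) else y p.2].
Proof.
elim: s p => [|q s IH] [x t].
  rewrite /= andbT inE => xt.
  pose f y b : 'I_d := if on [:: x] y then ordS b else b.
  exists (ctl [:: x] t (shiftX C d)), (fun y => upd y t (f y (y t))); split.
  - rewrite mulr0 add0r; apply: synthesizable_ctl1 => //.
    exact: (shiftX_unitary C d 1).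
  - apply: monomial_blk => y a b; rewrite /f; case: ifP => _ /negPf ab.
      by rewrite mxE ab.
    by rewrite mxE ab.
  - by move=> y l /=; rewrite inE => lt; rewrite upd_other.
  - by move=> y /=; rewrite upd_same.
move=> U; have {U} [xt xs ts qs] : [/\ x != t, x \notin unzip2 (q :: s),
    t \notin unzip1 (q :: s) ++ unzip2 (q :: s)
    & uniq (unzip1 (q :: s) ++ unzip2 (q :: s))].
  move: U; rewrite -[unzip1 _]/(x :: unzip1 (q :: s)) -[unzip2 _]/(t :: unzip2 (q :: s)).
  move: (unzip1 (q :: s)) (unzip2 (q :: s)) => l1 l2.
  have /perm_uniq -> : perm_eq ((x :: l1) ++ t :: l2) (x :: t :: l1 ++ l2).
    by rewrite perm_cons -cat1s (perm_catCA l1 [:: t] l2).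
  rewrite !cons_uniq inE mem_cat => /and3P[/norP[xt /norP[_ xl2]] tl l12].
  by split.
have [V [sigma [Vc Vm Vfr Vtop]]] := IH q qs.
move: ts; rewrite mem_cat negb_or => /andP[ts1 ts2].
have qt : q.2 != t by apply: contraNneq ts2 => <-; rewrite inE eqxx.
have [F [Fc Fm Fm']] := relative_phase_gate xt qt.
exists (F *m V *m F^t*).
pose g y := upd y t (toff_inv x q.2 y (y t)).
pose f y := upd y t (toff_fun x q.2 y (y t)).
exists (f \o sigma \o g); split.
- have -> : 2 * (2 * w + 1) * (size (q :: s))%:Z + d%:Z
      = (2 * w + 1) + (2 * (2 * w + 1) * (size s)%:Z + d%:Z) + (2 * w + 1).
    by rewrite /= intS; ring.
  by do 2?[apply: synthesizable_mul] => //; apply: synthesizable_adj.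
- by do 2?[apply: monomial_mul].
- move=> y l /=; rewrite inE => /norP[lt lq]; rewrite /f /g upd_other// Vfr//.
  by rewrite upd_other.
move=> y; rewrite -[LHS]/(f (sigma (g y)) t).
rewrite -[on _ y]/((y x == d.-1 :> nat) && on (unzip1 (q :: s)) y) -[(x, t).2]/t.
rewrite /f upd_same /toff_fun (Vfr (g y)) // Vtop (Vfr (g y))//.
have onE : on (unzip1 (q :: s)) (g y) = on (unzip1 (q :: s)) y by rewrite on_upd.
rewrite onE /g upd_same (upd_other _ _ xt) (upd_other _ _ qt) /toff_inv.
case: (y x == d.-1 :> nat); rewrite ?andTb//.
case: (on (unzip1 (q :: s)) y); last by rewrite iter_ord_predK.
(* The target becomes t - a + (a + 1); the reduction of a + 1 modulo d is harmless because the shift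
   has order d. *)
apply: val_inj; rewrite /= val_iter_ordS /= modnDmr -val_iter_ordS iterS.
by rewrite iter_ord_predK.
Qed.

(** The ladder takes one ancilla fewer than there are controls. It enters as V and as V^*, whence
    the factor 2; the diagonal gates on the target are free. *)
Lemma synthesizable_ctl_dirty x S t (anc : seq 'I_n) U :
  size anc = size S -> uniq (x :: S ++ t :: anc) -> U \is unitarymx -> \det U = 1 ->
  synthesizable (2 * (2 * (2 * w + 1) * (size S)%:Z + d%:Z)) (ctl (x :: S) t U).
Proof.
move=> szanc uS Uu detU; have [Q [delta [Qu delta1 UE]]] := unitary_diagonalizable Uu.
have tS : t \notin x :: S.
  by move: uS; rewrite -cat_cons cat_uniq /= => /and3P[_ /norP[]].
have prod1 : \prod_b delta b = 1.
  by rewrite -det_diagm -detU UE det_unitary_conj.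
have [alpha [alpha1 deltaE]] := prod1_coboundary delta1 prod1.
rewrite UE; apply: synthesizable_ctl_conj => //.
have [|V [sigma [Vc Vm _ Vtop]]] := @ladder (x, t) (zip S anc).
  by rewrite /= unzip1_zip ?szanc// unzip2_zip ?szanc.
rewrite /= unzip1_zip ?szanc// size_zip szanc minnn in Vc Vtop.
(* Only the value of the target after [V] enters V^* A V. *)
pose phi y b := alpha (if on (x :: S) y then ordS b else b).
have AE : blk t (fun=> diagm alpha) = diag_op (fun y => alpha (y t)).
  exact/esym/(diag_op_blk t (fun=> alpha)).
have AVE : V^t* *m blk t (fun=> diagm alpha) *m V = blk t (fun y => diagm (phi y)).
  rewrite AE -mulmxA -(monomial_diag_op (fun y => alpha (y t)) Vm) mulmxA.
  rewrite unitary_adjmulK ?mul1mx; last exact: synthesizable_unitary Vc.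
  rewrite -(diag_op_blk t phi);   by apply: eq_diag_op => y /=; rewrite Vtop /phi; case: ifP.
have -> : ctl (x :: S) t (diagm delta)
    = V^t* *m blk t (fun=> diagm alpha) *m V *m blk t (fun=> (diagm alpha)^t*).
  rewrite AVE blk_mul; last by move=> y b; rewrite /phi on_upd.
  apply: eq_blk => y; rewrite diagm_adj diagmM /phi; case: ifP => _.
    by apply: eq_diagm => b; rewrite deltaE.
  by rewrite -diagm_const; apply: eq_diagm => b; rewrite norm1_conj.
have Du : diagm alpha \is unitarymx by apply/diagm_unitaryP.
have -> (N : int) : 2 * N = N + 0 + N + 0 by lia.
do 3?[apply: synthesizable_mul] => //; first exact: synthesizable_adj.
  exact: synthesizable_single.
by apply: synthesizable_single; rewrite trmxC_unitary.
Qed.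

(** Each half borrows its ancillas from the other and needs one fewer than its own size; the halves
    differ in size by at most one, so there are enough. *)
Lemma synthesizable_ctl_linear S t U : (1 < size S)%N -> uniq (t :: S) ->
  U \is unitarymx -> \det U = 1 ->
  synthesizable (8 * (2 * w + 1) * ((size S)%:Z - 2) + 8 * d%:Z) (ctl S t U).
Proof.
move=> S1 uS Uu detU.
have [A [B [[Au detA] [Bu detB] ->]]] := SU_commutator d_gt0 Uu detU.
have [x1 [T1 [x2 [T2 [SE le1 le2]]]]] : exists x1 T1 x2 T2,
    [/\ S = (x1 :: T1) ++ x2 :: T2, (size T1 <= (size T2).+1)%N
      & (size T2 <= (size T1).+1)%N].
  have szt : size (take (size S)./2 S) = (size S)./2 by rewrite size_take; case: ltnP; lia.
  have := size_drop (size S)./2 S; have := cat_take_drop (size S)./2 S.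
  case: (take _ _) szt => [|x1 T1] /= e1; first lia.
  case: (drop _ _) => [|x2 T2] /= E e2; first lia.
  by exists x1, T1, x2, T2; split; rewrite ?E//; lia.
rewrite {S S1}SE in uS *.
have [tS1 tS2] : t \notin x1 :: T1 /\ t \notin x2 :: T2.
  by move: uS; rewrite cons_uniq mem_cat => /andP[/norP[]].
have dirty x T x' T' (V : 'M[C]_d) : uniq (t :: (x :: T) ++ x' :: T') -> (size T <= (size T').+1)%N ->
    V \is unitarymx -> \det V = 1 ->
    synthesizable (2 * (2 * (2 * w + 1) * (size T)%:Z + d%:Z)) (ctl (x :: T) t V).
  move=> u le Vu detV.
  apply: (@synthesizable_ctl_dirty x T t (take (size T) (x' :: T')) V) => //.
    by rewrite size_takel.
  have : uniq ((t :: x :: T) ++ take (size T) (x' :: T')).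
    move: u; rewrite -{1}(cat_take_drop (size T) (x' :: T')) catA -cat_cons cat_uniq.
    by case/andP.
  move=> u'; rewrite -(perm_uniq (s1 := [:: t] ++ (x :: T) ++ take (size T) (x' :: T')))//.
  by rewrite (perm_catCA [:: t] (x :: T)) perm_refl.
have u21 : uniq (t :: (x2 :: T2) ++ x1 :: T1).
  rewrite -(perm_uniq (s1 := t :: (x1 :: T1) ++ x2 :: T2))//.
  by rewrite perm_cons perm_catC perm_refl.
have -> : 8 * (2 * w + 1) * ((size ((x1 :: T1) ++ x2 :: T2))%:Z - 2) + 8 * d%:Z
    = 2 * (2 * (2 * (2 * w + 1) * (size T1)%:Z + d%:Z))
    + 2 * (2 * (2 * (2 * w + 1) * (size T2)%:Z + d%:Z)).
  by rewrite size_cat /= PoszD !intS; ring.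
by apply: synthesizable_commutator => //; apply: dirty; eauto.
Qed.

End Ladder.

(** * The two bounds for many controls *)

Section MultiControlled.
Variables (C : numClosedFieldType) (n d : nat).
Hypothesis d_prime : prime d.
Implicit Types (t : 'I_n) (S : seq 'I_n) (U : 'M[C]_d).

Let d_gt0 : (0 < d)%N := prime_gt0 d_prime.

(** The linear construction meets the bound except for d = 3 with 6 or 7 controls, where the
    recursive one is cheap enough. *)
Lemma synthesizable_ctl_SU S t U : (6 <= size S)%N -> uniq (t :: S) ->
  U \is unitarymx -> \det U = 1 ->
  synthesizable (d%:Z * N_SU d (size S).+1) (ctl S t U).
Proof.
move=> S6 tS Uu detU.
have [/andP[/eqP d3 S7]|] := boolP ((d == 3%N) && (size S <= 7)%N).
  have /andP[tS' _] := tS; have S0 : (0 < size S)%N by lia.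
  apply: synthesizable_le (synthesizable_ctl_rec d_prime S0 tS' Uu detU).
  rewrite /N_SU d3 /=.
  have /orP[/eqP->|/eqP->] : (size S == 6) || (size S == 7) by lia.
    by rewrite (@N_SU_rec_interval 2).
  by rewrite (@N_SU_rec_interval 2).
move=> d3S; have S2 : (1 < size S)%N by lia.
apply: synthesizable_le (synthesizable_ctl_linear d_prime S2 tS Uu detU).
rewrite /cost_W /N_SU; move: d3S.
have [->|d2] := eqVneq d 2%N; first by move=> _ /=; lia.
have [->|d3] := eqVneq d 3%N => /= H; first by lia.
(* Measured from d = 4 and 6 controls, the inequality becomes one between polynomials in nonnegative
   variables. *)
have [e ->] : exists e, d = (e + 4)%N by exists (d - 4)%N; have := prime_gt1 d_prime; lia.
have [k ->] : exists k, size S = (k + 6)%N by exists (size S - 6)%N; lia.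
rewrite -subr_ge0 intS !PoszD; move: (ler0n int e) (ler0n int k); rewrite !natz.
move: e%:Z k%:Z => u v u0 v0; nia.
Qed.

(** Induction on the number of controls: the last term of [N_U] pays for [z *: U] of determinant 1,
    and the preceding ones for the scalar [z^*], realized with one control fewer. *)
Lemma synthesizable_ctl S t U : (0 < size S)%N -> uniq (t :: S) ->
  U \is unitarymx -> synthesizable (d%:Z * N_U d (size S).+1) (ctl S t U).
Proof.
elim: S t U => // x [|x' S'] IH t U _ txS Uu.
  (* With one control the sum is empty and the allowance is 2 d, of which d is spent. *)
  rewrite /N_U big_geq// addr0; apply: synthesizable_le (_ : d%:Z <= _) _; first lia.
  by apply: synthesizable_ctl1 => //; move: txS; rewrite /= inE eq_sym; case: eqP.
move: (x' :: S') (isT : (0 < size (x' :: S'))%N) txS IH => {x' S'} S S0 txS IH.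
have [z [z1 detzU]] := scale_det1 d_gt0 Uu.
have [tS xS] : t \notin x :: S /\ uniq (x :: S) by move/andP: txS.
have -> : ctl (x :: S) t U = ctl (x :: S) t (z *: U) *m ctl (x :: S) t (z^*%:M).
  by rewrite ctl_mul// mul_mx_scalar scalerA mulrC norm1_conj// scale1r.
have zUu := scale_unitary z1 Uu.
rewrite /N_U big_nat_recr//= addrA -/(N_U d (size S).+1) mulrDr addrC.
apply: synthesizable_mul; last first.
  have [xnS _] : x \notin S /\ uniq S by move/andP: xS.
  apply: synthesizable_ctl_phase; rewrite ?norm_conjC//.
  apply: IH => //; apply/diagm_unitaryP => b.
  by case: ifP; rewrite ?normr1 ?norm_conjC.
have rec : synthesizable (d%:Z * N_SU_rec (size S).+2) (ctl (x :: S) t (z *: U)).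
  exact: (synthesizable_ctl_rec d_prime (S := x :: S)).
(* Whichever term attains the minimum, a circuit of that cost exists. *)
case: ifP => // S6; rewrite minEle; case: ifP => // _.
by apply: (synthesizable_ctl_SU (S := x :: S)) => //=; lia.
Qed.

End MultiControlled.

Theorem mainTheorem5 (R : realType) (d : nat) (d_prime : prime d) :
  (forall n : nat, (7 <= n)%N ->
     forall U : 'M[R[i]]_d, U \is unitarymx -> \det U = 1 ->
       synthesizable (d%:Z * N_SU d n) (controlled n U)) /\
  (forall n : nat, (3 <= n)%N ->
     forall U : 'M[R[i]]_d, U \is unitarymx ->
       synthesizable (d%:Z * N_U d n) (controlled n U)).
Proof.
have others n (t : 'I_n.+1) : let S := [seq k <- enum 'I_n.+1 | k != t] in
    uniq (t :: S) /\ size S = n.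
  split; first by rewrite /= mem_filter eqxx filter_uniq// enum_uniq.
  rewrite size_filter (eq_count (a2 := predC (pred1 t)))//.
  have := count_predC (pred1 t) (enum 'I_n.+1).
  by rewrite count_uniq_mem ?enum_uniq// mem_enum size_enum_ord => -[].
split=> -[//|n] n_large U Uu.
  move=> detU; rewrite (controlled_ctl U (t := ord_max))//.
  have [tS szS] := others n ord_max; rewrite -[in N_SU d _]szS.
  by apply: synthesizable_ctl_SU; rewrite // szS.
rewrite (controlled_ctl U (t := ord_max))//.
have [tS szS] := others n ord_max; rewrite -[in N_U d _]szS.
by apply: synthesizable_ctl; rewrite // szS; lia.
Qed.
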